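(* Let $HV$ be the loop Heisenberg-Virasoro Lie algebra over $\mathbb{C}$, with basis $\{L_{\alpha,i},H_{\beta,j}\mid\alpha,\beta,i,j\in\mathbb{Z}\}$ and brackets $[L_{\alpha,i},L_{\beta,j}]=(\alpha-\beta)L_{\alpha+\beta,i+j}$, $[L_{\alpha,i},H_{\beta,j}]=-\beta H_{\alpha+\beta,i+j}$, $[H_{\alpha,i},H_{\beta,j}]=0$. For $i,j\in\mathbb{Z}$ let $L_i(z)=\sum_{\alpha\in\mathbb{Z}}L_{\alpha,i}z^{-\alpha-2}$ and $H_j(z)=\sum_{\beta\in\mathbb{Z}}H_{\beta,j}z^{-\beta-1}$ in $HV[[z,z^{-1}]]$. Then for all $i,j\in\mathbb{Z}$, in $HV[[z,z^{-1},w,w^{-1}]]$, $$[L_i(z),L_j(w)]=(\partial_wL_{i+j}(w))\delta(z,w)+2L_{i+j}(w)\partial_w\delta(z,w),$$ $$[L_i(z),H_j(w)]=(\partial_wH_{i+j}(w))\delta(z,w)+H_{i+j}(w)\partial_w\delta(z,w),$$ $$[H_i(z),L_j(w)]=H_{i+j}(w)\partial_w\delta(z,w),$$ $$[H_i(z),H_j(w)]=0.$$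
   Context: For a complex vector space $U$, $U[[z,z^{-1}]]$ denotes the space of formal distributions, i.e. two-sided infinite formal series $\sum_{n\in\mathbb{Z}}u_nz^{n}$ with $u_n\in U$; $U[[z,z^{-1},w,w^{-1}]]$ is defined similarly in two variables. For a Lie algebra $g$ and $a(z)=\sum_m a_mz^m$, $b(w)=\sum_n b_nw^n$ with coefficients in $g$, $[a(z),b(w)]=\sum_{m,n}[a_m,b_n]z^mw^n$. The formal delta distribution is $\delta(z,w)=\sum_{i\in\mathbb{Z}}z^iw^{-i-1}$, and $\partial_w$ is the formal derivative with respect to $w$. *)

(* Defs.v *)
From HB Require Import structures.
From mathcomp Require Import all_boot all_order all_algebra.
From mathcomp Require Import finmap.
From mathcomp Require Import boolp classical_sets functions cardinality fsbigop.
From mathcomp Require Import monalg.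
From mathcomp Require Import ring.

Set Implicit Arguments.
Unset Strict Implicit.
Unset Printing Implicit Defensive.

Import Order.TTheory GRing.Theory Num.Theory.

Local Open Scope classical_set_scope.
Local Open Scope ring_scope.

HB.mixin Record Lmodule_isLieAlgebra (K : fieldType) V of GRing.Lmodule K V := {
  lie : V -> V -> V;
  lie_linearl : forall y, linear (lie^~ y);
  lie_linearr : forall x, linear (lie x);
  liexx : forall x, lie x x = 0;
  lie_jacobi : forall x y z,
    lie x (lie y z) + lie y (lie z x) + lie z (lie x y) = 0
}.

#[short(type="lieAlgType")]
HB.structure Definition LieAlgebra (K : fieldType) :=
  { V of Lmodule_isLieAlgebra K V & GRing.Lmodule K V }.

(* A series in U[[z,z^-1]] is its family of coefficients a : int -> U, with
   a n the coefficient of z^n; a series in U[[z,z^-1,w,w^-1]] is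
   a : int -> int -> U, with a m n the coefficient of z^m w^n. Sums, scalings
   and 0 are the pointwise ones on function types. *)
Definition fdist (U : Type) := int -> U.
Definition fdist2 (U : Type) := int -> int -> U.

Definition fderiv (U : zmodType) (a : fdist U) : fdist U :=
  fun n => a (n + 1) *~ (n + 1).

Definition fderiv_w (U : zmodType) (a : fdist2 U) : fdist2 U :=
  fun m => fderiv (a m).

Definition fdelta (K : pzRingType) : fdist2 K :=
  fun m n => (n == - m - 1)%:R.
Arguments fdelta {K}.

(* The product a(w) g(z,w), by the Cauchy rule in w. It makes sense when each
   coefficient is a finite sum; \sum_(_ \in _) is the sum over the finite
   support, and [fmulw_finite_support] together with [fdelta_wfinite] and
   [fderiv_w_wfinite] shows that no junk value is involved when g is the delta
   distribution or its derivative. *)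
Definition fmulw (K : pzRingType) (U : lmodType K) (a : fdist U) (g : fdist2 K)
    : fdist2 U :=
  fun m n => \sum_(k \in [set: int]) g m (n - k) *: a k.

Definition fbracket (K : fieldType) (g : lieAlgType K) (a b : fdist g)
    : fdist2 g :=
  fun m n => lie (a m) (b n).

Definition wfinite (U : zmodType) (g : fdist2 U) :=
  forall m, finite_set [set n | g m n != 0].

Lemma fdelta_wfinite (K : pzRingType) : wfinite (@fdelta K).
Proof.
move=> m; apply: (@sub_finite_set _ _ [set - m - 1]); last exact: finite_set1.
by move=> n /=; rewrite /fdelta; case: (n =P _) => // _; rewrite eqxx.
Qed.

Lemma fderiv_w_wfinite (U : zmodType) (g : fdist2 U) :
  wfinite g -> wfinite (fderiv_w g).
Proof.
move=> gfin m.
apply: (@sub_finite_set _ _ ((fun n => n - 1) @` [set n | g m n != 0])).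
  move=> n /= gn; exists (n + 1); last by rewrite addrK.
  by apply: contraNneq gn => g0; rewrite /fderiv_w /fderiv g0 mul0rz.
exact/finite_image/gfin.
Qed.

Lemma fmulw_finite_support (K : pzRingType) (U : lmodType K)
    (a : fdist U) (g : fdist2 K) m n :
  wfinite g -> finite_set [set k | g m (n - k) *: a k != 0].
Proof.
move=> gfin.
apply: (@sub_finite_set _ _ ((fun l => n - l) @` [set l | g m l != 0])).
  move=> k /= gk; exists (n - k); last by rewrite opprB addrC subrK.
  by apply: contraNneq gk => ->; rewrite scale0r.
exact/finite_image/gfin.
Qed.

Inductive hv_index : Type := IdxL of int & int | IdxH of int & int.

Definition hv_index_code (x : hv_index) : (int * int) + (int * int) :=
  match x with IdxL a i => inl (a, i) | IdxH a i => inr (a, i) end.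

Definition hv_index_decode (x : (int * int) + (int * int)) : hv_index :=
  match x with inl p => IdxL p.1 p.2 | inr p => IdxH p.1 p.2 end.

Lemma hv_index_codeK : cancel hv_index_code hv_index_decode.
Proof. by case. Qed.

HB.instance Definition _ := Choice.copy hv_index (can_type hv_index_codeK).

Section FreeLift.
Variables (K : comNzRingType) (I : choiceType) (V : lmodType K).

(* {malg K[I]} is the free K-module on I: finitely supported functions. *)
Definition flift (f : I -> V) (x : {malg K[I]}) : V :=
  \sum_(k <- msupp x) x@_k *: f k.

Lemma fliftEw (f : I -> V) (d : {fset I}) x : (msupp x `<=` d)%fset ->
  flift f x = \sum_(k <- d) x@_k *: f k.
Proof.
move=> le_xd; rewrite /flift (big_fset_incl _ le_xd) // => k _ kx.
by rewrite mcoeff_outdom // scale0r.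
Qed.

Lemma flift_linear f : linear (flift f).
Proof.
move=> c x y.
have le1 : (msupp x `<=` msupp x `|` msupp y)%fset by exact: fsubsetUl.
have le2 : (msupp y `<=` msupp x `|` msupp y)%fset by exact: fsubsetUr.
have le3 : (msupp (c *: x + y) `<=` msupp x `|` msupp y)%fset.
  apply: fsubset_trans (msuppD_le _ _) _.
  by apply: fsetSU; exact: msuppZ_le.
rewrite (fliftEw _ le1) (fliftEw _ le2) (fliftEw _ le3) scaler_sumr -big_split /=.
by apply: eq_bigr => k _; rewrite mcoeffD mcoeffZ scalerDl scalerA.
Qed.

Lemma fliftU f k : flift f << k >> = f k.
Proof.
by rewrite /flift msuppU oner_eq0 big_seq_fset1 mcoeffUU scale1r.
Qed.

Lemma eq_flift f f' x : f =1 f' -> flift f x = flift f' x.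
Proof. by move=> e; apply: eq_bigr => k _; rewrite e. Qed.

Lemma flift_linear_fun c f f' x :
  flift (fun k => c *: f k + f' k) x = c *: flift f x + flift f' x.
Proof.
rewrite /flift scaler_sumr -big_split /=; apply: eq_bigr => k _.
by rewrite scalerDr !scalerA mulrC.
Qed.

Lemma malg_lin_eq (f g : {malg K[I]} -> V) : linear f -> linear g ->
  (forall k, f << k >> = g << k >>) -> f =1 g.
Proof.
move=> lf lg e x; rewrite (monalgE x).
have l0 (h : {malg K[I]} -> V) : linear h -> h 0 = 0.
  by move=> lh; have := lh (-1) 0 0; rewrite scaler0 addr0 scaleN1r addNr.
elim/big_ind: _ => [|y z|k _]; first by rewrite !l0.
- by have := lf 1 y z; have := lg 1 y z; rewrite !scale1r => -> -> -> ->.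
- have -> : << x@_k *g k >> = x@_k *: << k >> + 0 :> {malg K[I]}.
    by rewrite addr0; apply/malgP => k'; rewrite mcoeffZ !mcoeffU mulr_natr.
  by rewrite lf lg e !l0.
Qed.

End FreeLift.

Section HV.
Variable K : numFieldType.

(* The free module on the symbols L_(a,i), H_(a,i), under a name of its own so
   that the Lie bracket is attached to this type only. *)
Definition HV : Type := {malg K[hv_index]}.
HB.instance Definition _ := GRing.Lmodule.copy HV {malg K[hv_index]}.

Definition HVL (a i : int) : HV := << IdxL a i >>.
Definition HVH (a i : int) : HV := << IdxH a i >>.

Definition hv_base_bracket (x y : hv_index) : HV :=
  match x, y with
  | IdxL a i, IdxL b j => (a - b)%:~R *: HVL (a + b) (i + j)
  | IdxL a i, IdxH b j => (- b)%:~R *: HVH (a + b) (i + j)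
  | IdxH a i, IdxL b j => a%:~R *: HVH (a + b) (i + j)
  | IdxH _ _, IdxH _ _ => 0
  end.

Definition hv_bracket (x y : HV) : HV :=
  flift (fun k => flift (hv_base_bracket k) y) x.

Lemma hv_bracketl y : linear (hv_bracket^~ y).
Proof. exact: flift_linear. Qed.

Lemma hv_bracketr x : linear (hv_bracket x).
Proof.
move=> c y z; rewrite -flift_linear_fun; apply: eq_flift => k.
exact: flift_linear.
Qed.

Lemma hv_bracketUU k l : hv_bracket << k >> << l >> = hv_base_bracket k l.
Proof. by rewrite /hv_bracket !fliftU. Qed.

Let hv_bracket0r x : hv_bracket x 0 = 0.
Proof.
by have := hv_bracketr x (-1) 0 0; rewrite scaler0 addr0 scaleN1r addNr.
Qed.

Let hv_bracketZr x c y : hv_bracket x (c *: y) = c *: hv_bracket x y.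
Proof. by have := hv_bracketr x c y 0; rewrite !addr0 hv_bracket0r addr0. Qed.

Lemma hv_bracketC x y : hv_bracket x y = - hv_bracket y x.
Proof.
have linN (f : HV -> HV) : linear f -> linear (fun x => - f x).
  by move=> lf c u v; rewrite lf opprD scalerN.
move: x; apply: malg_lin_eq; first exact: hv_bracketl.
  exact/linN/hv_bracketr.
move=> k; move: y; apply: malg_lin_eq; first exact: hv_bracketr.
  exact/linN/hv_bracketl.
move=> l; rewrite !hv_bracketUU.
case: k => a i; case: l => b j /=; rewrite ?oppr0 // -scaleNr.
- by rewrite -mulrNz opprB (addrC b) (addrC j).
- by rewrite -mulrNz (addrC b) (addrC j).
- by rewrite -mulrNz opprK (addrC b) (addrC j).
Qed.

Lemma hv_bracketxx x : hv_bracket x x = 0.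
Proof.
have /eqP := hv_bracketC x x; rewrite -addr_eq0 -mulr2n -scaler_nat.
by rewrite scaler_eq0 pnatr_eq0 /= => /eqP.
Qed.

Lemma hv_jacobi x y z :
  hv_bracket x (hv_bracket y z) + hv_bracket y (hv_bracket z x)
    + hv_bracket z (hv_bracket x y) = 0.
Proof.
have lin0 : linear (fun _ : HV => 0 : HV).
  by move=> c u v; rewrite scaler0 addr0.
have linD (f g : HV -> HV) : linear f -> linear g -> linear (fun x => f x + g x).
  by move=> lf lg c u v; rewrite lf lg scalerDr addrACA.
have linC (f g : HV -> HV) : linear f -> linear g -> linear (fun x => f (g x)).
  by move=> lf lg c u v; rewrite lg lf.
have lr := hv_bracketr; have ll := hv_bracketl.
move: x; apply: malg_lin_eq => //; first do 2?apply: (linD _ _).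
- exact: ll.
- by apply: (linC _ _); [exact: lr | exact: lr].
- by apply: (linC (hv_bracket z)); [exact: lr | exact: ll].
move=> k; move: y; apply: malg_lin_eq => //; first do 2?apply: (linD _ _).
- by apply: (linC (hv_bracket _)); [exact: lr | exact: ll].
- exact: ll.
- by apply: (linC _ _); [exact: lr | exact: lr].
move=> l; move: z; apply: malg_lin_eq => //; first do 2?apply: (linD _ _).
- by apply: (linC _ _); [exact: lr | exact: lr].
- by apply: (linC (hv_bracket _)); [exact: lr | exact: ll].
- exact: ll.
move=> m {lin0 linC lr ll}.
move: hv_bracket hv_bracket0r hv_bracketZr hv_bracketUU => B B0 BZ BUU.
have sum3 (u v w : K) (x : HV) :
    u + v + w = 0 -> u *: x + (v *: x + w *: x) = 0.
  by move=> e; rewrite -!scalerDl addrA e scale0r.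
rewrite !BUU; case: k => a i; case: l => b j; case: m => c h /=;
  rewrite ?B0 ?BZ ?BUU /= ?scaler0 ?addr0 ?add0r // ?scalerA;
  rewrite (addrC b (c + a)) (addrC j (h + i)) -(addrA c) -(addrA h)
          (addrC c (a + b)) (addrC h (i + j)) -!addrA;
  by apply: sum3; rewrite !(rmorphB, rmorphD, rmorphN) /=; ring.
Qed.

HB.instance Definition _ := Lmodule_isLieAlgebra.Build K HV
  hv_bracketl hv_bracketr hv_bracketxx hv_jacobi.

Lemma lieLL a b i j :
  lie (HVL a i) (HVL b j) = (a - b)%:~R *: HVL (a + b) (i + j).
Proof. exact: hv_bracketUU. Qed.

Lemma lieLH a b i j :
  lie (HVL a i) (HVH b j) = (- b)%:~R *: HVH (a + b) (i + j).
Proof. exact: hv_bracketUU. Qed.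

Lemma lieHL a b i j :
  lie (HVH a i) (HVL b j) = a%:~R *: HVH (a + b) (i + j).
Proof. exact: hv_bracketUU. Qed.

Lemma lieHH a b i j : lie (HVH a i) (HVH b j) = 0.
Proof. exact: hv_bracketUU. Qed.

Definition hv_gen (k : hv_index) : HV :=
  match k with IdxL a i => HVL a i | IdxH a i => HVH a i end.

Let hv_genE k : hv_gen k = << k >>. Proof. by case: k. Qed.

Lemma hv_gen_span (x : HV) :
  exists (s : seq hv_index) (c : hv_index -> K),
    x = \sum_(k <- s) c k *: hv_gen k.
Proof.
exists (msupp (x : {malg K[hv_index]})), (fun k => mcoeff k x).
rewrite [LHS]monalgE; apply: eq_bigr => k _; apply/malgP => l.
by rewrite hv_genE mcoeffZ !mcoeffU mulr_natr.
Qed.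

Lemma hv_gen_free (s : seq hv_index) (c : hv_index -> K) : uniq s ->
  \sum_(k <- s) c k *: hv_gen k = 0 -> {in s, forall k, c k = 0}.
Proof.
move=> us s0 k ks; have := congr1 (mcoeff k) s0.
rewrite mcoeff0 raddf_sum (bigD1_seq k) //= big1 ?addr0.
  by rewrite hv_genE mcoeffZ mcoeffUU mulr1.
by move=> l /negPf lk; rewrite hv_genE mcoeffZ mcoeffU lk mulr0.
Qed.

(* L_i(z) = \sum_a L_(a,i) z^(-a-2) and H_i(z) = \sum_a H_(a,i) z^(-a-1):
   the exponent n is attained at a = -n-2, resp. a = -n-1. *)
Definition HVLz (i : int) : fdist HV := fun n => HVL (- n - 2) i.
Definition HVHz (i : int) : fdist HV := fun n => HVH (- n - 1) i.

End HV.

(* Main.v *)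
Require Import Defs.
From mathcomp Require Import all_boot all_order all_algebra.
From mathcomp Require Import complex functions reals.
From mathcomp Require Import classical_sets boolp fsbigop ring.

Import GRing.Theory.
Local Open Scope ring_scope.

(** Compare the coefficients of [z^m w^n]. For fixed [m], both the delta distribution and its
    [w]-derivative have at most one nonzero coefficient in [w], so by [fmulw_single] each product on
    the right collapses to one term. Both kinds of product then give a multiple of the coefficient
    at [m + n + 2] ([fmulw_fderiv], [fmulw_fderiv_fdelta]), which is also where the bracket of modes
    lands; only an identity between integer scalars remains. *)

Lemma fmulw_single (K : pzRingType) (U : lmodType K) (a : fdist U)
    (g : fdist2 K) (m n l : int) :
  (forall k, k != l -> g m k = 0) -> fmulw a g m n = g m l *: a (n - l).
Proof.
(* Only [k = n - l] makes the index [n - k] equal to [l]. *)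
move=> gl; rewrite /fmulw -(fsbig_widen [set n - l]%classic) //.
  by rewrite fsbig_set1 opprB addrC subrK.
move=> k [_ /= kl]; rewrite gl ?scale0r //; apply/eqP => nkl.
by apply: kl; rewrite -nkl opprB addrC subrK.
Qed.

Lemma fmulw_fdelta (K : pzRingType) (U : lmodType K) (a : fdist U) (m n : int) :
  fmulw a fdelta m n = a (m + n + 1).
Proof.
rewrite (@fmulw_single _ _ _ _ _ _ (- m - 1)) => [|k /negPf km].
  by rewrite /fdelta eqxx scale1r; congr a; ring.
by rewrite /fdelta km.
Qed.

Lemma fmulw_fderiv (K : pzRingType) (U : lmodType K) (a : fdist U) (m n : int) :
  fmulw (fderiv a) fdelta m n = (m + n + 2)%:~R *: a (m + n + 2).
Proof. by rewrite fmulw_fdelta /fderiv -scaler_int -addrA. Qed.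

Lemma fmulw_fderiv_fdelta (K : pzRingType) (U : lmodType K) (a : fdist U)
    (m n : int) :
  fmulw a (fderiv_w fdelta) m n = (- m - 1)%:~R *: a (m + n + 2).
Proof.
(* Differentiating [w^(-m-1)] gives [(-m-1) w^(-m-2)], whence both the exponent and the scalar. *)
rewrite (@fmulw_single _ _ _ _ _ _ (- m - 2)) => [|k km].
  rewrite /fderiv_w /fderiv /fdelta.
  have -> : - m - 2 + 1 = - m - 1 :> int by ring.
  by rewrite eqxx; congr (_ *: a _); ring.
rewrite /fderiv_w /fderiv /fdelta; case: eqP => [km1|_]; last by rewrite mul0rz.
by case/eqP: km; rewrite -(addrK 1 k) km1; ring.
Qed.

Theorem proposition3p1 (R : realType) (i j : int) :
  [/\ fbracket (HVLz R[i] i) (HVLz R[i] j)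
        = fmulw (fderiv (HVLz R[i] (i + j))) fdelta
          + 2 *: fmulw (HVLz R[i] (i + j)) (fderiv_w fdelta),
      fbracket (HVLz R[i] i) (HVHz R[i] j)
        = fmulw (fderiv (HVHz R[i] (i + j))) fdelta
          + fmulw (HVHz R[i] (i + j)) (fderiv_w fdelta),
      fbracket (HVHz R[i] i) (HVLz R[i] j)
        = fmulw (HVHz R[i] (i + j)) (fderiv_w fdelta)
    & fbracket (HVHz R[i] i) (HVHz R[i] j) = 0].
Proof.
split; apply/funext => m; apply/funext => n; rewrite /fbracket.
- rewrite !fctE fmulw_fderiv fmulw_fderiv_fdelta.
  rewrite /HVLz lieLL scalerA -scalerDl.
  congr (_ *: HVL _ _ _); last by ring.
  (* Once [2] is read as an integer cast, the claim is [(-m-2) - (-n-2) = (m+n+2) + 2(-m-1)]; both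
     sides are [n - m]. *)
  by rewrite -(intrM _ 2) -intrD; congr (_%:~R); ring.
- rewrite !fctE fmulw_fderiv fmulw_fderiv_fdelta.
  rewrite /HVHz lieLH -scalerDl -intrD.
  (* The scalars agree since [-(-n-1) = (m+n+2) + (-m-1)]. *)
  by congr (_%:~R *: HVH _ _ _); ring.
- rewrite fmulw_fderiv_fdelta /HVHz lieHL.
  by congr (_ *: HVH _ _ _); ring.
- exact: lieHH.
Qed.
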